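(* Let $\mathcal H$ be a symmetric Hadamard manifold with geodesic distance $d$. Let $\nu\in\{1,2\}$ and let $G\colon\mathcal H^2\to\mathbb R$, $G(x_0,x_1):=d(x_0,x_1)^\nu$. Then for every $\eta>0$ the reflection $\mathcal R_{\eta G}\colon\mathcal H^2\to\mathcal H^2$ is nonexpansive, i.e. $$d_{\mathcal H^2}\big(\mathcal R_{\eta G}(x),\mathcal R_{\eta G}(y)\big)\le d_{\mathcal H^2}(x,y)\qquad\text{for all }x,y\in\mathcal H^2.$$
   Context: A Hadamard space is a complete metric space $(\mathcal H,d)$ in which every two points are connected by a geodesic and $d(x,v)^2+d(y,w)^2\le d(x,w)^2+d(y,v)^2+2d(x,y)d(v,w)$ for all $x,y,v,w\in\mathcal H$. A Hadamard manifold is a Hadamard space which is at the same time a finite dimensional Riemannian manifold with geodesic distance $d$. On a Hadamard manifold $\exp_p$ denotes the Riemannian exponential map at $p$ and $\log_p$ its inverse. The geodesic reflection at $p$ is $R_p(x)=\exp_p(-\log_p x)$. The Hadamard manifold is symmetric if for every $p\in\mathcal H$ the reflection $R_p$ is an isometry: $d(R_p(x),R_p(y))=d(x,y)$ for all $x,y$. The product $\mathcal H^2=\mathcal H\times\mathcal H$ carries the distance $d_{\mathcal H^2}((x_0,x_1),(y_0,y_1))=\sqrt{d(x_0,y_0)^2+d(x_1,y_1)^2}$ and is again a Hadamard manifold. For a proper convex lower semicontinuous function $\varphi\colon\mathcal H^2\to(-\infty,+\infty]$ (convex means convex along all geodesics) and $\eta>0$, the proximal mapping is $\operatorname{prox}_{\eta\varphi}(x):=\operatorname*{arg\,min}_{y\in\mathcal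 H^2}\{\tfrac12 d_{\mathcal H^2}(x,y)^2+\eta\varphi(y)\}$, which exists and is unique, and the reflection of $\eta\varphi$ is $\mathcal R_{\eta\varphi}(x)=\exp_p(-\log_p x)$ with $p=\operatorname{prox}_{\eta\varphi}(x)$ (exponential and logarithm of $\mathcal H^2$). *)

(* Defs.v *)
From HB Require Import structures.
From mathcomp Require Import all_boot all_order all_algebra.
From mathcomp Require Import all_classical all_reals all_analysis.

Set Implicit Arguments.
Unset Strict Implicit.
Unset Printing Implicit Defensive.

Import Order.TTheory GRing.Theory Num.Theory.
Import numFieldNormedType.Exports.

Local Open Scope classical_set_scope.
Local Open Scope ring_scope.

(* [f] is of class C^k on the open set [U]: its iterated directional
   derivatives up to order [k] exist and are continuous on [U]. *)
Fixpoint Ck (R : realType) (V W : normedModType R) (k : nat)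
    (U : set V) (f : V -> W) : Prop :=
  (forall x, U x -> {for x, continuous f}) /\
  match k with
  | 0 => True
  | k'.+1 => forall v,
      (forall x, U x -> derivable f x v) /\ Ck k' U (fun x => 'D_v f x)
  end.

Definition smooth (R : realType) (V W : normedModType R)
    (U : set V) (f : V -> W) : Prop := forall k, Ck k U f.

Record chart (R : realType) (V : normedModType R) (X : topologicalType) := Chart {
  cdom : set X;
  cmap : X -> V;
  cinv : V -> X }.

(* Charts are indexed by points, [A p] being a chart around [p]. The tangent
   space at [p] is the model space [V], through the coordinates of [A p]. *)
Definition atlas (R : realType) (V : normedModType R) (X : topologicalType) :=
  X -> chart V X.

Record smooth_atlas (R : realType) (V : normedModType R) (X : topologicalType)
    (A : atlas V X) : Prop := {
  chart_center : forall p, cdom (A p) p;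
  chart_open : forall p, open (cdom (A p));
  chart_image_open : forall p, open (cmap (A p) @` cdom (A p));
  chart_cancel : forall p x, cdom (A p) x -> cinv (A p) (cmap (A p) x) = x;
  chart_continuous : forall p x, cdom (A p) x -> {for x, continuous (cmap (A p))};
  chart_inv_continuous : forall p x, cdom (A p) x ->
    {for cmap (A p) x, continuous (cinv (A p))};
  chart_transition : forall p q,
    smooth (cmap (A p) @` (cdom (A p) `&` cdom (A q))) (cmap (A q) \o cinv (A p)) }.

Definition prod_atlas (R : realType) (V : normedModType R) (X : topologicalType)
    (A : atlas V X) : atlas (V * V)%type (X * X)%type :=
  fun p => Chart
    (cdom (A p.1) `*` cdom (A p.2))
    (fun x => (cmap (A p.1) x.1, cmap (A p.2) x.2))
    (fun u => (cinv (A p.1) u.1, cinv (A p.2) u.2)).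

Definition Ck_curve (R : realType) (V : normedModType R) (X : topologicalType)
    (A : atlas V X) (k : nat) (c : R -> X) : Prop :=
  continuous c /\
  forall p, Ck k (c @^-1` cdom (A p) : set R^o) (cmap (A p) \o c : R^o -> V).

Definition smooth_curve (R : realType) (V : normedModType R) (X : topologicalType)
    (A : atlas V X) (c : R -> X) : Prop := forall k, Ck_curve A k c.

Definition velocity (R : realType) (V : normedModType R) (X : topologicalType)
    (A : atlas V X) (c : R -> X) (t : R) : V :=
  'D_1 (cmap (A (c t)) \o c : R^o -> V) t.

Definition quad (R : realType) (n : nat) (G : 'M[R]_n) (v : 'rV[R]_n) : R :=
  (v *m G *m v^T) 0 0.

Definition speed (R : realType) (n : nat) (X : topologicalType)
    (A : atlas 'rV[R]_n X) (gram : X -> 'rV[R]_n -> 'M[R]_n)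
    (c : R -> X) (t : R) : R :=
  Num.sqrt (quad (gram (c t) (cmap (A (c t)) (c t))) (velocity A c t)).

Definition curve_length (R : realType) (n : nat) (X : topologicalType)
    (A : atlas 'rV[R]_n X) (gram : X -> 'rV[R]_n -> 'M[R]_n)
    (c : R -> X) : \bar R :=
  (\int[lebesgue_measure]_(t in `[0%R, 1%R]) (speed A gram c t)%:E)%E.

(* [gram p u] is the Gram matrix of the metric tensor in the coordinates of
   the chart [A p], at the point of coordinates [u]. The curves in
   [dist_geodesic] need not be regular, so they may stop at corners and at
   their endpoints: piecewise C^1 curves on [0, 1] give the same infimum. *)
Record riemannian_manifold (R : realType) (n : nat) (H : metricType R) := {
  ratlas : atlas 'rV[R]_n H;
  gram : H -> 'rV[R]_n -> 'M[R]_n;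
  ratlas_smooth : smooth_atlas ratlas;
  gram_smooth : forall p,
    smooth (cmap (ratlas p) @` cdom (ratlas p)) (gram p);
  gram_sym : forall p x, cdom (ratlas p) x ->
    (gram p (cmap (ratlas p) x))^T = gram p (cmap (ratlas p) x);
  gram_pos : forall p x v, cdom (ratlas p) x -> v != 0 ->
    0 < quad (gram p (cmap (ratlas p) x)) v;
  gram_change : forall p q x v, cdom (ratlas p) x -> cdom (ratlas q) x ->
    quad (gram p (cmap (ratlas p) x)) v =
    quad (gram q (cmap (ratlas q) x))
      ('D_v (cmap (ratlas q) \o cinv (ratlas p)) (cmap (ratlas p) x));
  dist_geodesic : forall x y : H, (mdist x y)%:E =
    ereal_inf [set curve_length ratlas gram c |
               c in [set c | [/\ Ck_curve ratlas 1 c, c 0 = x & c 1 = y]]] }.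

Definition geodesic_segment (R : realType) (H : metricType R) (x y : H)
    (c : R -> H) : Prop :=
  [/\ c 0 = x, c 1 = y & forall s t, 0 <= s <= 1 -> 0 <= t <= 1 ->
      mdist (c s) (c t) = `|s - t| * mdist x y].

Record hadamard_space (R : realType) (H : metricType R) : Prop := {
  hadamard_complete : forall F : set_system H,
    ProperFilter F -> cauchy F -> exists l : H, F --> l;
  hadamard_geodesic : forall x y : H, exists c, geodesic_segment x y c;
  hadamard_ineq : forall x y v w : H,
    mdist x v ^+ 2 + mdist y w ^+ 2 <=
    mdist x w ^+ 2 + mdist y v ^+ 2 + 2 * mdist x y * mdist v w }.

(* Riemannian geodesics on the whole real line, as the smooth curves that
   locally realize the distance [d] with constant speed. *)
Definition riemannian_geodesic (R : realType) (V : normedModType R)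
    (X : topologicalType) (A : atlas V X) (d : X -> X -> R) (c : R -> X) : Prop :=
  smooth_curve A c /\
  exists l : R, forall t, exists2 e, 0 < e &
    forall r s, `|r - t| < e -> `|s - t| < e -> d (c r) (c s) = l * `|r - s|.

Definition is_exponential (R : realType) (V : normedModType R)
    (X : topologicalType) (A : atlas V X) (d : X -> X -> R) (e : X -> V -> X) : Prop :=
  forall p v,
    [/\ riemannian_geodesic A d (fun t => e p (t *: v)),
        e p 0 = p,
        velocity A (fun t => e p (t *: v)) 0 = v &
        forall c, riemannian_geodesic A d c -> c 0 = p -> velocity A c 0 = v ->
          forall t, c t = e p (t *: v)].

(* On a Hadamard manifold such a pair exists (Hopf-Rinow, Cartan-Hadamard),
   and it is unique. *)
Record exp_log (R : realType) (V : normedModType R) (X : topologicalType)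
    (A : atlas V X) (d : X -> X -> R) := {
  exp_map : X -> V -> X;
  log_map : X -> X -> V;
  exp_mapP : is_exponential A d exp_map;
  exp_mapK : forall p, cancel (exp_map p) (log_map p);
  log_mapK : forall p, cancel (log_map p) (exp_map p) }.

Definition reflection (R : realType) (V : normedModType R) (X : topologicalType)
    (A : atlas V X) (d : X -> X -> R) (E : exp_log A d) (p x : X) : X :=
  exp_map E p (- log_map E p x).

Definition symmetric_manifold (R : realType) (V : normedModType R)
    (X : topologicalType) (A : atlas V X) (d : X -> X -> R) (E : exp_log A d) : Prop :=
  forall p x y, d (reflection E p x) (reflection E p y) = d x y.

Definition dist2 (R : realType) (H : metricType R) (x y : H * H) : R :=
  Num.sqrt (mdist x.1 y.1 ^+ 2 + mdist x.2 y.2 ^+ 2).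

Definition argmin (R : realType) (X : Type) (F : X -> \bar R) : set X :=
  [set y | forall z, (F y <= F z)%E].

(* The minimizer is unique when [phi] is proper, convex and lower
   semicontinuous on a Hadamard space and [d] is its distance; [x] is only a
   default value. *)
Definition prox (R : realType) (X : choiceType) (d : X -> X -> R)
    (eta : R) (phi : X -> \bar R) (x : X) : X :=
  xget x (argmin (fun y => (2^-1 * d x y ^+ 2)%:E + eta%:E * phi y)%E).

Definition prox_reflection (R : realType) (V : normedModType R)
    (X : topologicalType) (A : atlas V X) (d : X -> X -> R) (E : exp_log A d)
    (eta : R) (phi : X -> \bar R) (x : X) : X :=
  reflection E (prox d eta phi x) x.

(* Main.v *)
Require Import Defs.
From mathcomp Require Import all_boot all_order all_algebra.
From mathcomp Require Import all_classical all_reals all_analysis.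
From mathcomp Require Import ring lra.
Import Order.TTheory GRing.Theory Num.Theory.
Import numFieldNormedType.Exports.
Local Open Scope classical_set_scope.
Local Open Scope ring_scope.

Set Implicit Arguments.
Unset Strict Implicit.
Unset Printing Implicit Defensive.

(** The reflection never leaves the segment: the minimizer of the proximal
problem at [(x0, x1)] moves both points towards each other along the geodesic
[c] from [x0] to [x1], by the same amount [tau] with [2 tau <= D], where
[D = d(x0, x1)]. With [s D = 2 tau], the reflected pair is therefore
[(c s, c (1 - s))] with [0 <= s <= 1]. Here [2 tau] is [min (2 eta) D] for
[nu = 1] and a fixed multiple of [D] for [nu = 2]; in both cases it is a
nondecreasing and 1-Lipschitz function of [D].

Nonexpansiveness is then an inequality about two geodesics of a Hadamard space
([swapped_points_le]). Convexity of the squared distance, applied to each of the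
two geodesics, bounds
[d (c s) (c' t) ^ 2 + d (c (1 - s)) (c' (1 - t)) ^ 2] by a convex combination of
the straight sum [d x0 y0 ^ 2 + d x1 y1 ^ 2] and of the crossed sum
[d x0 y1 ^ 2 + d x1 y0 ^ 2], minus terms in [D ^ 2] and [D' ^ 2]. The
quadrilateral inequality trades the crossed sum for the straight one plus
[2 D D'], and what remains is twice
[(a - a') * (a - a' - (D - D'))], with [a = s D] and [a' = t D']. This product
is nonpositive exactly because [a] is monotone and 1-Lipschitz in [D].

Two facts have to be extracted from the definitions. First, convexity of the
squared distance is not part of the definition of a Hadamard space, which only
has the quadrilateral inequality and geodesics; this is one direction of the
theorem of Berg and Nikolaev. Let [defect p z y b] be the excess of [d p b ^ 2],
where [b] is the midpoint of [z] and [y], over the value predicted by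
Euclidean geometry. At [p] it is at most twice its value at the midpoint of [p]
and [y] ([defect_halving]), while it is at most quadratic in the distance from
[p] to [y] ([defect_le_near_vertex]); moving [p] to [y] by successive halvings
shows that it is nonpositive ([median_le]).

Second, the reflection is defined by the exponential map of the product
manifold. The exponential map of [H] gives a smooth curve from [x0] to [x1]
defined on the whole real line and locally minimizing; convexity of the squared
distance makes it globally minimizing ([local_geodesic_global]). The pair of
two affine reparametrizations of this curve is a Riemannian geodesic of the
product through the minimizer and through [(x0, x1)], so by uniqueness it is
the geodesic along which one reflects ([reflection_inward]). *)

(** * Two halving arguments on real numbers *)

Lemma le0_of_halving {R : realType} (x C : R) :
  (forall k, x <= C / 2 ^+ k) -> x <= 0.
Proof.
move=> xC; rewrite leNgt; apply/negP => x0.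
have C0 : 0 <= C by have := xC 0%N; rewrite expr0 divr1; lra.
set k := Num.bound (C / x).
have : C / x < 2 ^+ k.
  apply: lt_trans (archi_boundP (divr_ge0 C0 (ltW x0))) _.
  by rewrite -natrX ltr_nat ltn_expl.
rewrite ltr_pdivrMr // => Cx.
by have := xC k; rewrite ler_pdivlMr ?exprn_gt0 // mulrC; lra.
Qed.

(** Every point of [[0, 1]] is the midpoint of an endpoint and of another point
of the interval, so that an upper bound of [g] can be halved; boundedness
replaces the usual continuity assumption. *)
Lemma midpoint_convex_le0 {R : realType} (g : R -> R) (C : R) :
  g 0 <= 0 -> g 1 <= 0 ->
  (forall s t, 0 <= s <= 1 -> 0 <= t <= 1 -> g ((s + t) / 2) <= (g s + g t) / 2) ->
  (forall t, 0 <= t <= 1 -> g t <= C) ->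
  forall t, 0 <= t <= 1 -> g t <= 0.
Proof.
move=> g0 g1 gmid gC t t01; apply: (@le0_of_halving _ _ C) => k.
elim: k t t01 => [|k IHk] t t01; first by rewrite expr0 divr1 gC.
rewrite exprS invfM mulrCA mulrA mulrAC.
case/andP: t01 => t0 t1; have [th|th] := leP t 2^-1.
  have t2 : 0 <= 2 * t <= 1 by apply/andP; split; lra.
  have := gmid 0 (2 * t); rewrite (_ : (0 + 2 * t) / 2 = t); last by field.
  by rewrite lexx ler01 => /(_ isT t2); have := IHk _ t2; lra.
have t2 : 0 <= 2 * t - 1 <= 1 by apply/andP; split; lra.
have := gmid 1 (2 * t - 1); rewrite (_ : (1 + (2 * t - 1)) / 2 = t); last by field.
by rewrite lexx ler01 => /(_ isT t2); have := IHk _ t2; lra.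
Qed.

(** * Convexity of the squared distance *)

Section HadamardMetric.
Context {R : realType} {H : metricType R}.
Hypothesis hadamardH : hadamard_space H.
Local Notation d := (@mdist R H).

(** The inequality with both diagonals on the left, where the product of the
opposite sides [a b] and [c e] is bounded by the mean of their squares. It is an
equality for the parallelograms of the Euclidean plane. *)
Lemma quadrilateral (a b c e : H) :
  d a c ^+ 2 + d b e ^+ 2 <=
  d a b ^+ 2 + d b c ^+ 2 + d c e ^+ 2 + d e a ^+ 2.
Proof.
have := hadamard_ineq hadamardH a b c e.
have := sqr_ge0 (d a b - d c e).
rewrite (metric_sym e a); lra.
Qed.

Definition midpoint (x y m : H) : Prop :=
  d x m = d x y / 2 /\ d y m = d x y / 2.

Lemma midpoint_exists x y : exists m, midpoint x y m.
Proof.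
have [c [c0 c1 cd]] := hadamard_geodesic hadamardH x y.
have I0 : 0 <= (0 : R) <= 1 by rewrite lexx ler01.
have I1 : 0 <= (1 : R) <= 1 by rewrite lexx ler01.
have Ih : 0 <= (2^-1 : R) <= 1 by rewrite invr_ge0 ler0n invf_le1 ?ltr0n ?ler1n.
exists (c 2^-1); split.
  by rewrite -[in LHS]c0 (cd _ _ I0 Ih) sub0r normrN ger0_norm ?invr_ge0 // mulrC.
rewrite -[in LHS]c1 (cd _ _ I1 Ih) ger0_norm ?subr_ge0 ?invf_le1 ?ler1n //.
by rewrite {1}(splitr 1) mul1r addrK mulrC.
Qed.

(** The deviation from Apollonius' median formula, for [b] the midpoint of [z]
and [y]; it vanishes in the Euclidean plane. *)
Definition defect (p z y b : H) : R :=
  d p b ^+ 2 - (d p z ^+ 2 + d p y ^+ 2) / 2 + d z y ^+ 2 / 4.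

(** The degenerate quadrilateral [z p y b] alone, which loses a factor 2 on
[d p b ^+ 2]. *)
Lemma defect_le_median p z y b :
  midpoint z y b -> defect p z y b <= d p b ^+ 2 / 2.
Proof.
move=> [zb yb]; have := quadrilateral z p y b; rewrite /defect.
rewrite (metric_sym b z) zb yb (metric_sym z p) expr_div_n; lra.
Qed.

(** In the medial triangle [a m b] of [z p y], both [z a m b] and [p a b m] are
parallelograms in the Euclidean case. Adding their quadrilateral inequalities
cancels the sides [a b] and [a m]; the term [d z m ^+ 2] and the two copies of
[d m b ^+ 2] that remain are those of [2 * defect m z y b]. *)
Lemma defect_halving p z y b m :
  midpoint z y b -> midpoint p y m -> defect p z y b <= 2 * defect m z y b.
Proof.
move=> [zb yb] [pm ym]; have [a [za pa]] := midpoint_exists z p.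
have P1 := quadrilateral z a m b; have P2 := quadrilateral p a b m.
move: P1 P2; rewrite /defect.
rewrite (metric_sym b z) (metric_sym m p) (metric_sym b m).
rewrite (metric_sym m z) (metric_sym m y) (metric_sym p z).
rewrite za pa zb pm ym !expr_div_n; lra.
Qed.

(** Let [a] be the midpoint of [z] and [q]. The quadrilateral inequality for the
sides [a b] and [y q], of product [d a b * d y q], bounds the sum of
[d q b ^+ 2] and [d a y ^+ 2] from above, while [defect_le_median] at [a] bounds
[d a y ^+ 2] from below in terms of [d a b ^+ 2]. What remains is
[2 * d a b * d q y - d a b ^+ 2 - d q y ^+ 2 / 2], at most [d q y ^+ 2 / 2]. *)
Lemma defect_le_near_vertex q z y b :
  midpoint z y b -> defect q z y b <= d q y ^+ 2 / 2.
Proof.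
move=> zyb; have [a zqa] := midpoint_exists z q.
have Da := defect_le_median a zyb.
have S := hadamard_ineq hadamardH a b y q.
move: zyb zqa Da S => [zb yb] [za qa]; rewrite /defect.
rewrite (metric_sym a z) (metric_sym b q) (metric_sym b y).
rewrite (metric_sym q z) (metric_sym y q) (metric_sym a q) yb za qa !expr_div_n.
have := sqr_ge0 (d a b - d q y); lra.
Qed.

(** Replacing [p] by its midpoint with [y] costs a factor 2 on the defect but
divides the bound [d p y ^+ 2 / 2] by 4, so that every such step halves the
bound on the original defect. *)
Lemma median_le p z y b : midpoint z y b ->
  d p b ^+ 2 <= (d p z ^+ 2 + d p y ^+ 2) / 2 - d z y ^+ 2 / 4.
Proof.
move=> zyb; suff: defect p z y b <= 0 by rewrite /defect; lra.
apply: (@le0_of_halving _ _ (d p y ^+ 2 / 2)) => k.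
elim: k p => [|k IHk] p; first by rewrite expr0 divr1 defect_le_near_vertex.
have [m pym] := midpoint_exists p y.
have := defect_halving zyb pym; have := IHk m.
case: pym => _; rewrite (metric_sym m y) => ->.
rewrite [2 ^+ k.+1]exprS invfM expr_div_n; set q := (2 ^+ k)^-1; lra.
Qed.

(** The defect of convexity in [t] is midpoint convex by [median_le], and it
vanishes at both ends of the geodesic. *)
Lemma geodesic_point_le p x y c t :
  geodesic_segment x y c -> 0 <= t <= 1 ->
  d p (c t) ^+ 2 <=
  (1 - t) * d p x ^+ 2 + t * d p y ^+ 2 - t * (1 - t) * d x y ^+ 2.
Proof.
move=> [c0 c1 cd] t01; rewrite -subr_le0; move: t t01.
have I0 : 0 <= (0 : R) <= 1 by rewrite lexx ler01.
apply: (@midpoint_convex_le0 _ _ ((d p x + d x y) ^+ 2 + d x y ^+ 2)) => /=.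
- by rewrite c0; lra.
- by rewrite c1; lra.
- move=> s t s01 t01; have m01 : 0 <= (s + t) / 2 <= 1.
    by move: s01 t01 => /andP[? ?] /andP[? ?]; apply/andP; split; lra.
  have smt : midpoint (c s) (c t) (c ((s + t) / 2)).
    have half (r : R) : `|r / 2| = `|r| / 2.
      by rewrite normrM (@ger0_norm _ 2^-1) ?invr_ge0.
    split; rewrite !cd // mulrAC -half.
      by rewrite (_ : s - (s + t) / 2 = (s - t) / 2) //; field.
    by rewrite (_ : t - (s + t) / 2 = - ((s - t) / 2)) ?normrN //; field.
  have := median_le p smt; rewrite (cd s t) // exprMn real_normK ?num_real //; lra.
- move=> t t01; case/andP: (t01) => t0 t1.
  have pc := metric_triangle p x (c t).
  have xc : d x (c t) = t * d x y.
    by rewrite -{1}c0 cd // sub0r normrN ger0_norm.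
  have D0 := mdist_ge0 x y.
  have := mdist_ge0 p (c t); have := sqr_ge0 (d p x); have := sqr_ge0 (d p y).
  have pcD : d p (c t) <= d p x + d x y by nra.
  have := mdist_ge0 p x; nra.
Qed.

Lemma geodesic_point_unique x y c t p :
  geodesic_segment x y c -> 0 <= t <= 1 ->
  d x p <= t * d x y -> d p y <= (1 - t) * d x y -> p = c t.
Proof.
move=> cxy t01 xp py; apply: mdist_positivity; apply/eqP.
rewrite -sqrf_eq0 eq_le sqr_ge0 andbT.
apply: le_trans (geodesic_point_le p cxy t01) _.
case/andP: t01 => t0 t1; rewrite (metric_sym p x).
have xp2 : d x p ^+ 2 <= (t * d x y) ^+ 2.
  by rewrite ler_sqr ?nnegrE ?mulr_ge0 ?mdist_ge0.
have py2 : d p y ^+ 2 <= ((1 - t) * d x y) ^+ 2.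
  by rewrite ler_sqr ?nnegrE ?mulr_ge0 ?mdist_ge0 ?subr_ge0.
have := ler_wpM2l t0 py2; have t1' : 0 <= 1 - t by lra.
have := ler_wpM2l t1' xp2; lra.
Qed.

Lemma geodesics_points_le x0 x1 c y0 y1 c' s t :
  geodesic_segment x0 x1 c -> geodesic_segment y0 y1 c' ->
  0 <= s <= 1 -> 0 <= t <= 1 ->
  d (c s) (c' t) ^+ 2 <=
  (1 - s) * (1 - t) * d x0 y0 ^+ 2 + (1 - s) * t * d x0 y1 ^+ 2 +
  s * (1 - t) * d x1 y0 ^+ 2 + s * t * d x1 y1 ^+ 2 -
  s * (1 - s) * d x0 x1 ^+ 2 - t * (1 - t) * d y0 y1 ^+ 2.
Proof.
move=> cx cy s01 t01.
have Q := geodesic_point_le (c s) cy t01.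
have Q0 := geodesic_point_le y0 cx s01.
have Q1 := geodesic_point_le y1 cx s01.
rewrite (metric_sym _ y0) (metric_sym _ y1) in Q.
rewrite (metric_sym x0 y0) (metric_sym x1 y0) (metric_sym x0 y1) (metric_sym x1 y1).
apply: le_trans Q _; case/andP: t01 => t0 t1.
have t1' : 0 <= 1 - t by lra.
have := ler_wpM2l t0 Q1; have := ler_wpM2l t1' Q0; lra.
Qed.

(** The hypothesis says that the distances [a = s * d x0 x1] and
[a' = t * d y0 y1] travelled along the two geodesics satisfy
[0 <= a - a' <= d x0 x1 - d y0 y1], or the same with both signs reversed. *)
Lemma swapped_points_le x0 x1 c y0 y1 c' s t :
  geodesic_segment x0 x1 c -> geodesic_segment y0 y1 c' ->
  0 <= s <= 1 -> 0 <= t <= 1 ->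
  (s * d x0 x1 - t * d y0 y1) *
  (s * d x0 x1 - t * d y0 y1 - (d x0 x1 - d y0 y1)) <= 0 ->
  d (c s) (c' t) ^+ 2 + d (c (1 - s)) (c' (1 - t)) ^+ 2 <=
  d x0 y0 ^+ 2 + d x1 y1 ^+ 2.
Proof.
move=> cx cy s01 t01 st.
have P0 := geodesics_points_le cx cy s01 t01.
have rev (r : R) : 0 <= r <= 1 -> 0 <= 1 - r <= 1.
  by case/andP => ? ?; apply/andP; split; lra.
have P1 := geodesics_points_le cx cy (rev _ s01) (rev _ t01).
have Q := hadamard_ineq hadamardH x0 x1 y1 y0.
have w0 : 0 <= (1 - s) * t + s * (1 - t).
  by case/andP: s01 => ? ?; case/andP: t01 => ? ?; rewrite addr_ge0 ?mulr_ge0; lra.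
rewrite (metric_sym y1 y0) in Q.
have := ler_wpM2l w0 Q; lra.
Qed.

(** * Local geodesics are global *)

(** Suppose that [c] realizes the distance from [c a] up to the parameter [s].
On a short interval centred at [s], [c s] is a midpoint, and [median_le] then
bounds the distance from [c a] to the far end of the interval from below by the
value that the triangle inequality gives as an upper bound. The length
of this interval is uniform near the supremum of the good parameters, which
therefore cannot be finite. *)
Lemma local_geodesic_global (c : R -> H) (l : R) :
  (forall t, exists2 e, 0 < e & forall r s, `|r - t| < e -> `|s - t| < e ->
     d (c r) (c s) = l * `|r - s|) ->
  forall r s, d (c r) (c s) = l * `|r - s|.
Proof.
move=> cl.
suff le_case a b : a <= b -> d (c a) (c b) = l * (b - a).
  move=> r s; have [rs|sr] := leP r s.
    by rewrite le_case // distrC ger0_norm ?subr_ge0.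
  by rewrite metric_sym le_case ?(ltW sr) // gtr0_norm ?subr_gt0.
have [e0 e00 cl0] := cl a.
have nb (x t e : R) : t - e < x < t + e -> `|x - t| < e.
  by move=> /andP[? ?]; rewrite ltr_norml; apply/andP; split; lra.
have l0 : 0 <= l.
  have E : d (c a) (c (a + e0 / 2)) = l * (e0 / 2).
    rewrite cl0; try by apply: nb; apply/andP; split; lra.
    by rewrite distrC ger0_norm; [congr (_ * _); ring|lra].
  by have := mdist_ge0 (c a) (c (a + e0 / 2)); rewrite E pmulr_lge0 //; lra.
pose good b := forall t, a <= t <= b -> d (c a) (c t) = l * (t - a).
suff all_good b' : good b'.
  by move=> ab; apply: (all_good b); rewrite ab lexx.
apply: contrapT => bad.
pose S := [set b'' | good b'']%classic.
have Sub : ubound S b'.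
  move=> s Ss; rewrite leNgt; apply/negP => bs; apply: bad => t /andP[at_ tb].
  by apply: Ss; rewrite at_ /=; lra.
have Se0 : S (a + e0 / 2).
  move=> t /andP[at_ te]; rewrite cl0; first by rewrite distrC ger0_norm ?subr_ge0.
    by apply: nb; apply/andP; split; lra.
  by apply: nb; apply/andP; split; lra.
(* [e0] makes the supremum differ from [a], which leaves room to reflect the
   parameter [t] through [s] without passing [a]. *)
have supS : has_sup S by split; [exists (a + e0 / 2)|exists b'].
set m := sup S.
have am : a + e0 / 2 <= m by apply: ub_le_sup => //; exists b'.
have [e ege0 cle] := cl m.
pose del := Num.min e (m - a) / 4.
have dele : 4 * del <= e by rewrite /del mulrC divfK ?ge_min ?lexx ?pnatr_eq0.
have delm : 4 * del <= m - a.
  by rewrite /del mulrC divfK ?ge_min ?lexx ?orbT ?pnatr_eq0.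
have del0 : 0 < del by rewrite divr_gt0 ?lt_min ?ege0 //=; lra.
have [s Ss ms] := sup_adherent del0 supS; rewrite -/m in ms.
have sm : s <= m by apply: ub_le_sup => //; exists b'.
suff : S (m + del) by move=> Sm; have := ub_le_sup (ex_intro _ b' Sub) Sm; rewrite -/m; lra.
move=> t /andP[at_ tm]; have [ts|st] := leP t s; first by apply: Ss; rewrite at_.
have near_m x : m - 3 * del <= x <= m + del -> `|x - m| < e.
  by move=> /andP[? ?]; apply: nb; apply/andP; split; lra.
(* [2 * s - t] is the parameter symmetric to [t] with respect to [s]. *)
have N0 : `|(2 * s - t) - m| < e by apply: near_m; apply/andP; split; lra.
have N1 : `|s - m| < e by apply: near_m; apply/andP; split; lra.
have N2 : `|t - m| < e by apply: near_m; apply/andP; split; lra.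
have D01 : d (c (2 * s - t)) (c s) = l * (t - s).
  by rewrite cle // distrC ger0_norm; [congr (_ * _); ring|lra].
have D12 : d (c s) (c t) = l * (t - s).
  by rewrite cle // distrC ger0_norm; [congr (_ * _); ring|lra].
have D02 : d (c (2 * s - t)) (c t) = 2 * (l * (t - s)).
  by rewrite cle // distrC ger0_norm; [ring|lra].
have M : midpoint (c (2 * s - t)) (c t) (c s).
  by split; rewrite D02 ?D01 1?[d (c t) _]metric_sym ?D12; field.
have As : d (c a) (c s) = l * (s - a) by apply: Ss; rewrite lexx andbT; lra.
have As' : d (c a) (c (2 * s - t)) = l * (2 * s - t - a).
  by apply: Ss; apply/andP; split; lra.
apply/eqP; rewrite eq_le; apply/andP; split.
  apply: le_trans (metric_triangle _ (c s) _) _.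
  by rewrite As D12; lra.
rewrite -ler_sqr ?nnegrE ?mulr_ge0 ?mdist_ge0 ?subr_ge0 //.
by have := median_le (c a) M; rewrite As As' D02; lra.
Qed.

End HadamardMetric.

(** * Curves of class C^k *)

Lemma continuous_affine {R : realType} (a b : R) :
  continuous (fun r : R^o => a + b * r : R^o).
Proof.
by move=> r; apply: cvgD; [exact: cvg_cst|apply: cvgM; [exact: cvg_cst|exact: cvg_id]].
Qed.

Lemma Ck_affine {R : realType} {V : normedModType R} k (U : set R^o)
    (f : R^o -> V) (a b : R) : Ck k U f ->
  Ck k ((fun r => a + b * r) @^-1` U : set R^o) (fun r : R^o => f (a + b * r)).
Proof.
elim: k f => [|k IHk] f /= [cf df]; split => //.
- move=> r Ur; apply: (@continuous_comp _ _ _ (fun r : R^o => a + b * r : R^o) f).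
    exact: continuous_affine.
  exact: cf.
- move=> r Ur; apply: (@continuous_comp _ _ _ (fun r : R^o => a + b * r : R^o) f).
    exact: continuous_affine.
  exact: cf.
have quotE (v r : R^o) :
    (fun h => h^-1 *: (((fun r : R^o => f (a + b * r)) \o shift r) (h *: v) -
                       f (a + b * r))) =
    (fun h : R => h^-1 *: ((f \o shift (a + b * r : R^o)) (h *: (b * v : R^o)) -
                   f (a + b * r))).
  apply/funext => h /=; congr (_ *: (f _ - _)).
  by rewrite /GRing.scale /=; ring.
move=> v; split=> [r Ur|].
  by rewrite /derivable quotE; apply: (df (b * v)).1.
have -> : 'D_v (fun r : R^o => f (a + b * r)) =
          fun r : R^o => ('D_(b * v : R^o) f) (a + b * r).
  by apply/funext => r; rewrite /derive quotE.
exact: IHk (df (b * v)).2.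
Qed.

(** The function [h] is compared with the pair on [U] only, because the
directional derivative of a pair is the pair of the derivatives only where
both exist; the induction on [k] needs this freedom. *)
Lemma Ck_pair {R : realType} {T V W : normedModType R} k (U : set T)
    (f : T -> V) (g : T -> W) (h : T -> V * W) : open U ->
  Ck k U f -> Ck k U g -> (forall x, U x -> h x = (f x, g x)) -> Ck k U h.
Proof.
move=> Uo; elim: k f g h => [|k IHk] f g h /= [cf df] [cg dg] hfg.
all: have near_hfg x : U x -> \forall y \near x, (f y, g y) = h y by
  move=> Ux; near do rewrite hfg //; exact: open_nbhs_nbhs.
all: have ch x : U x -> {for x, continuous h} by
  move=> Ux; rewrite /prop_for /continuous_at hfg //;
  apply: cvg_trans (near_eq_cvg (near_hfg x Ux)) _;
  apply: cvg_pair; [exact: cf|exact: cg].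
  by split.
split=> // v.
have dpair x : U x ->
    (fun t => t^-1 *: (((fun y => (f y, g y)) \o shift x) (t *: v) - (f x, g x)))
      @ 0^' --> ('D_v f x, 'D_v g x).
  by move=> Ux; apply: cvg_pair; [exact: (df v).1|exact: (dg v).1].
split=> [x Ux|].
  apply: near_eq_derivable (near_hfg x Ux) _.
  by apply/cvg_ex; exists ('D_v f x, 'D_v g x); exact: dpair.
apply: IHk (df v).2 (dg v).2 _ => x Ux.
rewrite -(near_eq_derive v (near_hfg x Ux)).
exact: (cvg_lim (@norm_hausdorff _ _) (dpair x Ux)).
Unshelve. all: by end_near. Qed.

Lemma Ck_subset {R : realType} {V W : normedModType R} k (U U' : set V)
    (f : V -> W) : U' `<=` U -> Ck k U f -> Ck k U' f.
Proof.
move=> UU; elim: k f => [|k IHk] f /= [cf df]; split => //.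
- by move=> x /UU; exact: cf.
- by move=> x /UU; exact: cf.
by move=> v; split=> [x /UU|]; [exact: (df v).1|exact: IHk (df v).2].
Qed.

Lemma smooth_curve_pair_affine {R : realType} {V : normedModType R}
    {X : topologicalType} (A : atlas V X) (c : R -> X) (a b a' b' : R) :
  (forall p, open (cdom (A p))) -> smooth_curve A c ->
  smooth_curve (prod_atlas A) (fun r => (c (a + b * r), c (a' + b' * r))).
Proof.
move=> Ao sc k; have [cc _] := sc 0%N.
have caff e e' : continuous (fun r : R => c (e + e' * r)).
  move=> r; apply: (@continuous_comp _ _ _ (fun r : R => e + e' * r) c).
    exact: (@continuous_affine R).
  exact: cc.
split=> [r|p].
  by apply: cvg_pair; [exact: caff|exact: caff].
have [_ ck] := sc k.
apply: (@Ck_pair R _ _ _ k _ (fun r : R^o => cmap (A p.1) (c (a + b * r)))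
  (fun r : R^o => cmap (A p.2) (c (a' + b' * r)))) => //.
- apply: openI; apply: open_comp (Ao _) => r _; exact: caff.
- by apply: Ck_subset (Ck_affine a b (ck p.1)) => r [].
- by apply: Ck_subset (Ck_affine a' b' (ck p.2)) => r [].
Qed.

(** * Reflection along an explicit geodesic *)

(** The uniqueness clause of the exponential identifies [c] with the curve of
initial velocity [velocity A c 0], so that this velocity is the logarithm of
[c 1]. *)
Lemma reflection_geodesic {R : realType} {V : normedModType R}
    {X : topologicalType} {A : atlas V X} {dist : X -> X -> R}
    (E : exp_log A dist) (c : R -> X) :
  riemannian_geodesic A dist c -> reflection E (c 0) (c 1) = c (-1).
Proof.
move=> gc; set v := velocity A c 0.
have [_ _ _ uniq] := exp_mapP E (c 0) v.
have cE := uniq c gc erefl erefl.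
by rewrite /reflection (cE 1) scale1r exp_mapK (cE (-1)) scaleN1r.
Qed.

Lemma exp_log_line {R : realType} {H : metricType R} {V : normedModType R}
    {A : atlas V H} (hadamardH : hadamard_space H) (E : exp_log A (@mdist R H)) x y :
  exists c, [/\ smooth_curve A c, c 0 = x, c 1 = y &
    forall r s, mdist (c r) (c s) = mdist x y * `|r - s|].
Proof.
set v := log_map E x y; pose c t := exp_map E x (t *: v).
have [[sc [l loc]] e0 _ _] := exp_mapP E x v.
have c0 : c 0 = x by rewrite /c scale0r.
have c1 : c 1 = y by rewrite /c scale1r log_mapK.
have cl := local_geodesic_global hadamardH loc.
exists c; split => // r s; rewrite /c cl; congr (_ * _).
by rewrite -[X in mdist X _]c0 -c1 /c cl sub0r normrN1 mulr1.
Qed.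

Lemma line_geodesic_segment {R : realType} {H : metricType R} (x y : H) c :
  c 0 = x -> c 1 = y ->
  (forall r s : R, mdist (c r) (c s) = mdist x y * `|r - s|) ->
  geodesic_segment x y c.
Proof. by move=> c0 c1 cd; split=> // r s _ _; rewrite cd mulrC. Qed.

Lemma dist2_sq {R : realType} {H : metricType R} (x y : H * H) :
  dist2 x y ^+ 2 = mdist x.1 y.1 ^+ 2 + mdist x.2 y.2 ^+ 2.
Proof. by rewrite sqr_sqrtr // addr_ge0 ?sqr_ge0. Qed.

(** Both components run along the same line [c], at the same speed and in
opposite directions; the minimizing pair is the value at time 0, the original
pair the value at time 1, and the reflected pair the value at time -1. *)
Lemma reflection_inward {R : realType} {H : metricType R} {V : normedModType R}
    {A : atlas V H} (openA : forall p, open (cdom (A p)))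
    (E : exp_log (prod_atlas A) (@dist2 R H)) (c : R -> H) (D t : R) :
  smooth_curve A c -> (forall r s, mdist (c r) (c s) = D * `|r - s|) ->
  reflection E (c t, c (1 - t)) (c 0, c 1) = (c (2 * t), c (1 - 2 * t)).
Proof.
move=> sc cD.
pose c2 (r : R) := (c (t + - t * r), c (1 - t + t * r)).
have -> : (c t, c (1 - t)) = c2 0 by rewrite /c2 !mulr0 !addr0.
have -> : (c 0, c 1) = c2 1 by rewrite /c2 !mulr1 subrr subrK.
have -> : (c (2 * t), c (1 - 2 * t)) = c2 (-1).
  by rewrite /c2; congr (c _, c _); ring.
apply: reflection_geodesic; split.
  exact: smooth_curve_pair_affine.
exists (Num.sqrt (2 * (D * t) ^+ 2)) => t0; exists 1 => // r s _ _.
have -> : `|r - s| = Num.sqrt ((r - s) ^+ 2) by rewrite sqrtr_sqr.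
rewrite -sqrtrM; last by rewrite mulr_ge0 ?sqr_ge0.
rewrite /dist2 /c2 /= !cD; congr (Num.sqrt _); rewrite !exprMn !real_normK ?num_real //; ring.
Qed.

(** * The proximal mapping of a power of the distance *)

(** The triangle inequality reduces the minimization over pairs of points to a
minimization over three nonnegative reals of sum at least [D]. The two squares
on the left of the hypothesis express the strong convexity of that problem; they
force a minimizer to be at distance [t * D] from [x.1] and [x.2], hence on the
geodesic. *)
Lemma prox_inward {R : realType} {H : metricType R}
    (hadamardH : hadamard_space H) (eta : R) (nu : nat) (x : H * H) (c : R -> H) (t : R) :
  let D := mdist x.1 x.2 in
  (0 < nu)%N -> 0 < eta -> geodesic_segment x.1 x.2 c -> 0 <= t <= 2^-1 ->
  (forall u v w : R, 0 <= u -> 0 <= v -> 0 <= w -> D <= u + v + w ->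
     (t * D) ^+ 2 + eta * ((1 - 2 * t) * D) ^+ nu
       + (u - t * D) ^+ 2 / 2 + (v - t * D) ^+ 2 / 2
     <= (u ^+ 2 + v ^+ 2) / 2 + eta * w ^+ nu) ->
  prox (@dist2 R H) eta (fun z => (mdist z.1 z.2 ^+ nu)%:E) x = (c t, c (1 - t)).
Proof.
move=> D nu0 eta0 cx /andP[t0 th] Hmin.
have [c0 c1 cd] := cx.
have I0 : 0 <= (0 : R) <= 1 by rewrite lexx ler01.
have I1 : 0 <= (1 : R) <= 1 by rewrite lexx ler01.
have It : 0 <= t <= 1 by apply/andP; split; lra.
have It' : 0 <= 1 - t <= 1 by apply/andP; split; lra.
have D0 : 0 <= D := mdist_ge0 _ _.
have triD z : D <= mdist x.1 z.1 + mdist x.2 z.2 + mdist z.1 z.2.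
  have := metric_triangle x.1 z.1 x.2; have := metric_triangle z.1 z.2 x.2.
  rewrite (metric_sym z.2) -/D; lra.
have costE z : ((2^-1 * dist2 x z ^+ 2)%:E + eta%:E * (mdist z.1 z.2 ^+ nu)%:E)%E =
    ((mdist x.1 z.1 ^+ 2 + mdist x.2 z.2 ^+ 2) / 2 + eta * mdist z.1 z.2 ^+ nu)%:E
    :> \bar R.
  by rewrite dist2_sq -EFinM -EFinD [2^-1 * _]mulrC.
set P := (c t, c (1 - t)).
have PcostE : (mdist x.1 P.1 ^+ 2 + mdist x.2 P.2 ^+ 2) / 2
    + eta * mdist P.1 P.2 ^+ nu = (t * D) ^+ 2 + eta * ((1 - 2 * t) * D) ^+ nu.
  rewrite /P /= -c0 -c1 !cd //.
  rewrite sub0r normrN (ger0_norm t0) (_ : 1 - (1 - t) = t); last by ring.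
  rewrite (ger0_norm t0) distrC (_ : 1 - t - t = 1 - 2 * t); last by ring.
  by rewrite ger0_norm -/D; [lra|lra].
(* [xget] returns an unspecified minimizer, so every minimizer [y] is shown to
   be [P]; the default case is excluded because [P] is a minimizer. *)
rewrite /prox; case: xgetP => [y _ ymin|noP]; last first.
  exfalso; apply: (noP P) => z; rewrite !costE lee_fin PcostE.
  have := Hmin _ _ _ (mdist_ge0 x.1 z.1) (mdist_ge0 x.2 z.2)
    (mdist_ge0 z.1 z.2) (triD z).
  have := sqr_ge0 (mdist x.1 z.1 - t * D); have := sqr_ge0 (mdist x.2 z.2 - t * D).
  lra.
have := ymin P; rewrite !costE lee_fin PcostE => yP.
have := Hmin _ _ _ (mdist_ge0 x.1 y.1) (mdist_ge0 x.2 y.2)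
    (mdist_ge0 y.1 y.2) (triD y).
have q1 := sqr_ge0 (mdist x.1 y.1 - t * D).
have q2 := sqr_ge0 (mdist x.2 y.2 - t * D) => yH.
have e1 : mdist x.1 y.1 = t * D.
  by apply/eqP; rewrite -subr_eq0 -sqrf_eq0 eq_le q1 andbT; lra.
have e2 : mdist x.2 y.2 = t * D.
  by apply/eqP; rewrite -subr_eq0 -sqrf_eq0 eq_le q2 andbT; lra.
have e3 : mdist y.1 y.2 <= (1 - 2 * t) * D.
  have : eta * mdist y.1 y.2 ^+ nu <= eta * ((1 - 2 * t) * D) ^+ nu.
    by move: yP; rewrite e1 e2; lra.
  rewrite ler_pM2l // ler_pXn2r // nnegrE ?mdist_ge0 // mulr_ge0 //; lra.
rewrite [y]surjective_pairing /P; congr (_, _).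
  apply: (geodesic_point_unique hadamardH cx It); rewrite -/D ?e1 //.
  have := metric_triangle y.1 y.2 x.2; rewrite (metric_sym y.2) e2; lra.
apply: (geodesic_point_unique hadamardH cx It'); rewrite -/D.
  have := metric_triangle x.1 y.1 y.2; rewrite e1; lra.
by rewrite metric_sym e2; lra.
Qed.

(** The optimality condition of the scalar problem is [tau = eta] for [nu = 1],
unless the two points meet before, and [tau = 2 * eta * (D - 2 * tau)] for
[nu = 2]. *)
Lemma inward_step {R : realType} (nu : nat) (eta : R) :
  nu = 1%N \/ nu = 2%N -> 0 < eta -> exists tau : R -> R,
  [/\ forall D : R, 0 <= D -> 0 <= 2 * tau D <= D,
      forall D u v w : R, 0 <= D -> 0 <= u -> 0 <= v -> 0 <= w -> D <= u + v + w ->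
        tau D ^+ 2 + eta * (D - 2 * tau D) ^+ nu
          + (u - tau D) ^+ 2 / 2 + (v - tau D) ^+ 2 / 2
        <= (u ^+ 2 + v ^+ 2) / 2 + eta * w ^+ nu &
      forall D D', (2 * tau D - 2 * tau D') *
        (2 * tau D - 2 * tau D' - (D - D')) <= 0].
Proof.
move=> [->|->] eta0.
  exists (fun D => Num.min eta (D / 2)); split=> [D D0|D u v w D0 u0 v0 w0 Duvw|D D'].
  - by case: (leP eta (D / 2)) => ?; apply/andP; split; lra.
  - rewrite !expr1; case: (leP eta (D / 2)) => ?; nra.
  - by case: (leP eta (D / 2)) => ?; case: (leP eta (D' / 2)) => ?; nra.
pose s := 2 * eta / (1 + 4 * eta).
have s0 : 0 <= s by rewrite divr_ge0; lra.
have seta : s * (1 + 4 * eta) = 2 * eta by rewrite divfK // gt_eqF; lra.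
have s1 : 2 * s <= 1 by nra.
exists (fun D => s * D); split=> [D D0|D u v w D0 u0 v0 w0 Duvw|D D'].
- by apply/andP; split; nra.
- have sD : 0 <= s * D by rewrite mulr_ge0.
  have : 0 <= s * D * (u + v + w - D) by rewrite mulr_ge0 // subr_ge0.
  have : 0 <= eta * (w - (D - 2 * (s * D))) ^+ 2 by rewrite mulr_ge0 ?sqr_ge0 // ltW.
  have E : 2 * eta * (D - 2 * (s * D)) * (w - (D - 2 * (s * D))) =
           s * D * (w - (D - 2 * (s * D))).
    have etas : 2 * eta * (1 - 2 * s) = s by lra.
    rewrite (_ : D - 2 * (s * D) = (1 - 2 * s) * D); last by ring.
    by rewrite [X in X * _]mulrA etas.
  lra.
- rewrite (_ : _ * _ = - (2 * s * (1 - 2 * s) * (D - D') ^+ 2)); last by ring.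
  have s20 : 0 <= 2 * s * (1 - 2 * s) by apply: mulr_ge0; lra.
  by rewrite oppr_le0 mulr_ge0 ?sqr_ge0.
Qed.

(** * Nonexpansiveness *)

Theorem theorem6p3 (R : realType) (n : nat) (H : metricType R)
    (hadamardH : hadamard_space H)
    (M : riemannian_manifold n H)
    (E : exp_log (ratlas M) (@mdist R H))
    (symmetricH : symmetric_manifold E)
    (E2 : exp_log (prod_atlas (ratlas M)) (@dist2 R H))
    (nu : nat) (hnu : nu = 1%N \/ nu = 2%N)
    (eta : R) (heta : 0 < eta) (x y : H * H) :
  let G : H * H -> R := fun z => mdist z.1 z.2 ^+ nu in
  let reflG := prox_reflection E2 eta (fun z => (G z)%:E) in
  dist2 (reflG x) (reflG y) <= dist2 x y.
Proof.
cbv zeta; set reflG := prox_reflection _ _ _.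
have nu0 : (0 < nu)%N by case: hnu => ->.
have [tau [tauI tau_min tau_lip]] := inward_step hnu heta.
have openA := chart_open (ratlas_smooth M).
have reflE z : exists c s, [/\ geodesic_segment z.1 z.2 c, 0 <= s <= 1,
    s * mdist z.1 z.2 = 2 * tau (mdist z.1 z.2) & reflG z = (c s, c (1 - s))].
  have [c [sc c0 c1 cD]] := exp_log_line hadamardH E z.1 z.2.
  have cz := line_geodesic_segment c0 c1 cD.
  set D := mdist z.1 z.2 in cD *.
  have D0 : 0 <= D := mdist_ge0 _ _.
  have /andP[tau0 tauD] := tauI D D0.
  pose t := tau D / D.
  have tD : t * D = tau D.
    (* For [D = 0] the parameter is [t = 0], since division by zero gives 0. *)
    have [D00|Dn0] := eqVneq D 0; last by rewrite divfK.
    by move: tau0 tauD; rewrite /t D00 mulr0; lra.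
  have th : 0 <= t <= 2^-1.
    have [D00|Dn0] := eqVneq D 0.
      by rewrite /t D00 invr0 mulr0 lexx invr_ge0 ler0n.
    have Dp : 0 < D by rewrite lt_neqAle eq_sym Dn0.
    by rewrite divr_ge0 ?ler_pdivrMr //; lra.
  exists c, (2 * t); split=> //.
  - by case/andP: th => ? ?; apply/andP; split; lra.
  - by rewrite -mulrA tD.
  rewrite /reflG /prox_reflection (prox_inward hadamardH nu0 heta cz th) => [|u v w u0 v0 w0].
    have -> : z = (c 0, c 1) by rewrite c0 c1 -surjective_pairing.
    exact (reflection_inward openA E2 t sc cD).
  rewrite -/D tD mulrBl mul1r -mulrA tD; exact: tau_min.
have [c [s [cx s01 sD ->]]] := reflE x.
have [c' [s' [cy s01' sD' ->]]] := reflE y.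
rewrite -ler_sqr ?nnegrE ?sqrtr_ge0 // !dist2_sq /=.
by apply: (swapped_points_le hadamardH cx cy s01 s01'); rewrite sD sD' tau_lip.
Qed.
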